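(* Let $0\le r_1<r_2$, $\mathcal K=[-r_2,-r_1]$, $d\in\mathbb N$, and let $\varpi(\cdot)$ be as in the context. Let $U\in\mathbb S^n_{\succeq0}$, $n\in\mathbb N$, and let $\boldsymbol f(\cdot)\in\mathcal L^2_\varpi([-r_2,-r_1];\mathbb R^d)$ satisfy $\mathsf F:=\int_{-r_2}^{-r_1}\varpi(\tau)\boldsymbol f(\tau)\boldsymbol f^\top(\tau)d\tau\succ0$. Then for all $\boldsymbol x(\cdot)\in\mathcal L^2_\varpi(\mathcal K;\mathbb R^n)$, any $\varrho\in[r_1,r_2]$ and any $Y\in\mathbb R^{n\times n}$ satisfying $\begin{bmatrix}U&Y\\ Y^\top&U\end{bmatrix}\succeq0$, $$\begin{aligned}\int_{-r_2}^{-r_1}\varpi(\tau)\boldsymbol x^\top(\tau)U\boldsymbol x(\tau)d\tau&\ge[*]\left(\begin{bmatrix}U&Y\\ Y^\top&U\end{bmatrix}\otimes\mathsf F^{-1}\right)\begin{bmatrix}\int_{-\varrho}^{-r_1}(I_n\otimes\boldsymbol f(\tau))\boldsymbol x(\tau)\varpi(\tau)d\tau\\ \int_{-r_2}^{-\varrho}(I_n\otimes\boldsymbol f(\tau))\boldsymbol x(\tau)\varpi(\tau)d\tau\end{bmatrix}\\ &=[*]\left((\mathsf K_{(d,n)}\oplus\mathsf K_{(d,n)})\left(\begin{bmatrix}U&Y\\ Y^\top&U\end{bmatrix}\otimes\mathsf F^{-1}\right)(\mathsf K_{(n,d)}\oplus\mathsf K_{(n,d)})\right)\begin{bmatrix}\int_{-\varrho}^{-r_1}(\boldsymbol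 f(\tau)\otimes I_n)\boldsymbol x(\tau)\varpi(\tau)d\tau\\ \int_{-r_2}^{-\varrho}(\boldsymbol f(\tau)\otimes I_n)\boldsymbol x(\tau)\varpi(\tau)d\tau\end{bmatrix}.\end{aligned}$$
   Context: $[*]AX:=X^\top AX$; $\oplus$ block-diagonal sum; $\otimes$ Kronecker product; $\mathbb S^n_{\succeq0}$ real symmetric positive semidefinite matrices. $\mathsf K_{(n,d)}$ is the commutation matrix: $\mathsf K_{(n,d)}\mathbf{vec}(A)=\mathbf{vec}(A^\top)$ for all $A\in\mathbb R^{n\times d}$ ($\mathbf{vec}$ stacks columns). $\varpi:\mathcal K\to\mathbb R_{\ge0}$ is measurable with only finitely or countably infinitely many zeros; $\mathcal L^2_\varpi(\mathcal K;\mathbb R^d)$ is the set of measurable $\boldsymbol\phi:\mathcal K\to\mathbb R^d$ with $\int_{\mathcal K}\varpi\boldsymbol\phi^\top\boldsymbol\phi\,d\tau<\infty$. *)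

(* Defs.v *)
From HB Require Import structures.
From mathcomp Require Import all_boot all_order all_algebra.
From mathcomp Require Import all_classical all_reals all_analysis.
From mathcomp.real_closed Require Import mxtens.

Set Implicit Arguments.
Unset Strict Implicit.
Unset Printing Implicit Defensive.

Import Order.TTheory GRing.Theory Num.Theory.
Import numFieldNormedType.Exports.
Local Open Scope classical_set_scope.
Local Open Scope ring_scope.

Section MatrixNotions.
Variable R : realType.

(* [*]AX in the literature *)
Definition congmx m n (A : 'M[R]_m) (X : 'M[R]_(m, n)) : 'M[R]_n :=
  X^T *m A *m X.

Definition psdmx n (A : 'M[R]_n) : Prop :=
  A^T = A /\ forall v : 'cV[R]_n, 0 <= congmx A v 0 0.

Definition pdmx n (A : 'M[R]_n) : Prop :=
  A^T = A /\ forall v : 'cV[R]_n, v != 0 -> 0 < congmx A v 0 0.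

Definition dsummx m n p q (A : 'M[R]_(m, n)) (B : 'M[R]_(p, q)) :
  'M[R]_(m + p, n + q) := block_mx A 0 0 B.

(* mxtens_index (j, i) is the position j * m + i *)
Definition vec m n (A : 'M[R]_(m, n)) : 'cV[R]_(n * m) :=
  \col_k A (mxtens_unindex k).2 (mxtens_unindex k).1.

Definition commutation_mx (n d : nat) : 'M[R]_(n * d, d * n) :=
  \matrix_(k, l) (((mxtens_unindex k).1 == (mxtens_unindex l).2) &&
                   ((mxtens_unindex k).2 == (mxtens_unindex l).1))%:R.

Lemma commutation_mxP n d (K : 'M[R]_(n * d, d * n)) :
  (forall A : 'M[R]_(n, d), K *m vec A = vec A^T) <-> K = commutation_mx n d.
Proof.
have vecE (A : 'M[R]_(n, d)) : commutation_mx n d *m vec A = vec A^T.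
  apply/matrixP => k c; case: (mxtens_indexP k) => i j.
  rewrite !mxE !mxtens_indexK (bigD1 (mxtens_index (j, i)))//= big1 => [|l].
    by rewrite !mxE !mxtens_indexK !eqxx mul1r addr0.
  case: (mxtens_indexP l) => j' i' ne; rewrite !mxE !mxtens_indexK/=.
  case: andP => [[/eqP ei /eqP ej]|]; last by rewrite mul0r.
  by rewrite ei ej eqxx in ne.
split=> [KA|-> //]; apply/matrixP => k p; case: (mxtens_indexP p) => j i.
have e (M : 'M[R]_(n * d, d * n)) :
    M k (mxtens_index (j, i)) = (M *m vec (delta_mx i j)) k 0.
  rewrite mxE (bigD1 (mxtens_index (j, i)))//= big1 => [|l].
    by rewrite !mxE !mxtens_indexK !eqxx mulr1 addr0.
  case: (mxtens_indexP l) => j' i' ne; rewrite !mxE !mxtens_indexK/=.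
  case: andP => [[/eqP ei /eqP ej]|]; last by rewrite mulr0.
  by rewrite ei ej eqxx in ne.
by rewrite (e K) (e (commutation_mx n d)) KA vecE.
Qed.

(* I_n (x) v and v (x) I_n for a column v; the casts replace n * 1 and 1 * n
   by n. *)
Definition tens1mx n d (v : 'cV[R]_d) : 'M[R]_(n * d, n) :=
  castmx (erefl, muln1 n) ((1%:M : 'M[R]_n) *t v).

Definition tensmx1 n d (v : 'cV[R]_d) : 'M[R]_(d * n, n) :=
  castmx (erefl, mul1n n) (v *t (1%:M : 'M[R]_n)).

(* the Kronecker product of a 2 x 2 block matrix, in block form *)
Definition tens_block m n d (A : 'M[R]_(m + n)) (B : 'M[R]_d) :
  'M[R]_(m * d + n * d) :=
  castmx (mulnDl m n d, mulnDl m n d) (A *t B).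

End MatrixNotions.

Section Integration.
Variable R : realType.

(* The real line with the sigma-algebra of Lebesgue-measurable sets, the domain
   of [completed_lebesgue_measure]. *)
Definition leb_line := caratheodory_type ((wlength (@idfun R))^*)%mu.

Local Notation leb := (@completed_lebesgue_measure R).

(* column vectors with their Borel sigma-algebra *)
Definition borel_cV d := g_sigma_algebraType (@open 'cV[R]_d).

Definition mxRintegral m n (D : set R) (F : R -> 'M[R]_(m, n)) : 'M[R]_(m, n) :=
  \matrix_(i, j) Rintegral leb D (fun t => F t i j).

Definition weight (K : set R) (w : R -> R) : Prop :=
  [/\ measurable_fun (K : set leb_line) w,
      forall t, K t -> 0 <= w t
    & countable [set t | K t /\ w t = 0]].

Definition L2w d (K : set R) (w : R -> R) (phi : R -> 'cV[R]_d) : Prop :=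
  measurable_fun (K : set leb_line) (phi : leb_line -> borel_cV d) /\
  (\int[leb]_(t in K) (w t * ((phi t)^T *m phi t) 0 0)%:E < +oo)%E.

Definition gram d (K : set R) (w : R -> R) (f : R -> 'cV[R]_d) : 'M[R]_d :=
  mxRintegral K (fun t => w t *: (f t *m (f t)^T)).

End Integration.

(* Main.v *)
Require Import Defs.
From mathcomp Require Import all_boot all_order all_algebra.
From mathcomp Require Import all_classical all_reals all_analysis.
From mathcomp Require Import measurable_realfun.
From mathcomp.real_closed Require Import mxtens.
Set Implicit Arguments.
Unset Strict Implicit.
Unset Printing Implicit Defensive.

Import Order.TTheory GRing.Theory Num.Theory.
Import numFieldNormedType.Exports.
Local Open Scope classical_set_scope.
Local Open Scope ring_scope.

(** The inequality is Bessel's inequality for vector-valued functions, applied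
    to a doubled function.

    Write [W] for the block matrix with blocks [U], [Y], [Y^T], [U].  Cutting
    [x] at [- rho] gives [y := split_on B x], with values in ['cV_(n + n)],
    whose upper half is [x] on [t > - rho] and [0] elsewhere, and whose lower
    half is [x] on [t <= - rho] and [0] elsewhere.  At every point one of the
    two halves vanishes, so the off-diagonal blocks of [W] do not contribute
    and [y^T W y = x^T U x] pointwise, whatever [Y] is
    ([split_on_quadratic]).  On the other hand the moment matrix
    [A := \int w y f^T] is the moment matrix of [x] over the upper part
    of the interval stacked on the one over the lower part
    ([mxRintegral_split_on]).

    Bessel's inequality ([weighted_bessel]) says
    [\tr (W A F^-1 A^T) <= \int w y^T W y]: the residual
    [G := y - A F^-1 f] of the projection of [y] on the span of [f] has
    [\int w G G^T = \int w y y^T - A F^-1 A^T], and pairing it with the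
    positive semidefinite [W] yields a nonnegative number.

    It remains to recognise the trace as the Kronecker-product form of the
    statement: [(I (x) f) x] is the vectorisation of [(x f^T)^T] and
    [(f (x) I) x] that of [x f^T], so that [X] and [Z] are vectorised moment
    matrices.  Then [congmx_tens_block] evaluates the quadratic form as the
    trace, and the commutation matrix exchanges the two vectorisations, which
    gives the final equality. *)

Local Notation leb R := (@completed_lebesgue_measure R).

(** * Square-integrable vector functions *)

Lemma measurable_leb_line (R : realType) (A : set R) :
  measurable (A : set (measurableTypeR R)) -> measurable (A : set (leb_line R)).
Proof. exact: sub_caratheodory. Qed.

Lemma completed_lebesgue_set1 (R : realType) (r : R) :
  leb R [set r] = 0%E.
Proof. exact: lebesgue_measure_set1. Qed.

Lemma measurable_coord (R : realType) (d : nat) (D : set R)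
    (phi : R -> 'cV[R]_d) (i : 'I_d) :
  measurable_fun (D : set (leb_line R)) (phi : leb_line R -> borel_cV R d) ->
  measurable_fun (D : set (leb_line R)) (fun t => phi t i 0).
Proof.
move=> mphi.
have mcoord : measurable_fun setT (fun v : borel_cV R d => (v : 'cV[R]_d) i 0).
  apply: (measurability _ (RGenOpens.measurableE R)).
  move=> _ [_ [a [b ->]] <-]; rewrite setTI; apply: sub_sigma_algebra.
  have /continuousP := @coord_continuous R d 1 i 0.
  by apply; exact: interval_open.
exact: (measurableT_comp mcoord mphi).
Qed.

Lemma sqr_coord_le (R : realType) (d : nat) (v : 'cV[R]_d) (i : 'I_d) :
  v i 0 ^+ 2 <= (v^T *m v) 0 0.
Proof.
rewrite mxE (bigD1 i)//= mxE expr2 lerDl sumr_ge0// => j _.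
by rewrite mxE -expr2 sqr_ge0.
Qed.

(** Square integrability stated on coordinates: cutting a function with
    indicators preserves it by closure of real measurable functions under
    products, whereas measurability into the Borel sigma-algebra of ['cV_d]
    would require generating that sigma-algebra by coordinate sets. *)
Definition coordL2w (R : realType) (d : nat) (K : set R) (w : R -> R)
    (phi : R -> 'cV[R]_d) : Prop :=
  (forall i, measurable_fun (K : set (leb_line R)) (fun t => phi t i 0)) /\
  (\int[leb R]_(t in K)
     (w t * ((phi t)^T *m phi t) 0 0)%:E < +oo)%E.

Lemma L2w_coordL2w (R : realType) (d : nat) (K : set R) (w : R -> R)
    (phi : R -> 'cV[R]_d) : L2w K w phi -> coordL2w K w phi.
Proof.
by case=> mphi fin; split; [move=> i; exact: measurable_coord|exact: fin].
Qed.

Lemma coordL2w_integrable (R : realType) (d : nat) (K : set R) (w : R -> R)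
    (phi : R -> 'cV[R]_d) : measurable (K : set (leb_line R)) ->
  weight K w -> coordL2w K w phi ->
  (leb R).-integrable K
    (fun t => (w t * ((phi t)^T *m phi t) 0 0)%:E).
Proof.
move=> mK [mw w0 _] [mphi fin].
apply/integrableP; split.
  apply/measurable_EFinP; apply: measurable_funM; first exact: mw.
  under eq_fun => t do rewrite mxE.
  apply: measurable_sum => i; under eq_fun => t do rewrite mxE.
  by apply: measurable_funM; exact: mphi.
move: fin; congr (_ < _)%E; apply: eq_integral => t.
rewrite inE => Kt; rewrite gee0_abs// lee_fin mulr_ge0 ?w0//.
by rewrite mxE sumr_ge0// => i _; rewrite mxE -expr2 sqr_ge0.
Qed.

(** Domination: [|a b| <= a^2 + b^2], and each squared coordinate is at most
    the squared norm. *)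
Lemma coordL2w_mul_integrable (R : realType) (m d : nat) (K : set R) (w : R -> R)
    (phi : R -> 'cV[R]_m) (psi : R -> 'cV[R]_d) (i : 'I_m) (j : 'I_d) :
  measurable (K : set (leb_line R)) ->
  weight K w -> coordL2w K w phi -> coordL2w K w psi ->
  (leb R).-integrable K
    (fun t => (w t * (phi t i 0 * psi t j 0))%:E).
Proof.
move=> mK hw hphi hpsi; have [mw w0 _] := hw.
have ig := integrableD mK (coordL2w_integrable mK hw hphi) (coordL2w_integrable mK hw hpsi).
apply: (le_integrable mK _ _ ig).
  apply/measurable_EFinP; apply: measurable_funM; first exact: mw.
  by apply: measurable_funM; [exact: hphi.1|exact: hpsi.1].
move=> t Kt; rewrite /= lee_fin -mulrDr !normrM ler_wpM2l//.
apply: le_trans (ler_norm _); rewrite -normrM.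
have /le_trans -> // : `|phi t i 0 * psi t j 0| <= phi t i 0 ^+ 2 + psi t j 0 ^+ 2.
  rewrite normrM -[X in _ <= X + _]real_normK ?num_real//.
  rewrite -[X in _ <= _ + X]real_normK ?num_real//.
  set a := `| _ |; set b := `| _ |.
  have a0 : 0 <= a by exact: normr_ge0.
  have b0 : 0 <= b by exact: normr_ge0.
  have := sqr_ge0 (a - b); rewrite sqrrB => h.
  have ab0 : 0 <= a * b by exact: mulr_ge0.
  have : 0 <= (a ^+ 2 + b ^+ 2) - (a * b) *+ 2 by rewrite addrAC.
  by rewrite subr_ge0; apply: le_trans; rewrite mulr2n lerDl.
by rewrite lerD ?sqr_coord_le.
Qed.

(** * Entrywise integrals of matrix functions *)

Definition mxintegrable (R : realType) (m n : nat) (D : set R)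
    (F : R -> 'M[R]_(m, n)) : Prop :=
  forall i j, (leb R).-integrable D
    (fun t => (F t i j)%:E).

(** Integrability and value are proved together, here and in the matrix
    versions below, because the same rewriting of the integrand yields both. *)
Lemma Rintegral_lincomb (R : realType) (I : finType) (D : set R) (a : I -> R)
    (g : I -> R -> R) :
  measurable (D : set (leb_line R)) ->
  (forall i, (leb R).-integrable D (EFin \o g i)) ->
  (leb R).-integrable D
    (fun t => (\sum_i a i * g i t)%:E) /\
  Rintegral (leb R) D (fun t => \sum_i a i * g i t) =
  \sum_i a i * Rintegral (leb R) D (g i).
Proof.
move=> mD ig.
have iag i : (leb R).-integrable D
    (fun t => ((a i)%:E * (EFin \o g i) t)%E) by exact: integrableZl.
have sumE : (fun t => (\sum_i a i * g i t)%:E) =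
    (fun t => \sum_i ((a i)%:E * (EFin \o g i) t)%E).
  by apply/funext => t; rewrite -sumEFin.
rewrite sumE; split; first exact: integrable_sum.
rewrite /Rintegral [in LHS]sumE integral_sum// -sum_fine; last first.
  by move=> i _; exact: integrable_fin_num.
apply: eq_bigr => i _.
exact: (RintegralZl _ mD (ig i)).
Qed.

Section MatrixIntegral.
Variables (R : realType) (D : set R).
Hypothesis mD : measurable (D : set (leb_line R)).

Lemma mxintegrable_lin m n p q (P : 'M[R]_(p, m)) (Q : 'M[R]_(n, q))
    (F : R -> 'M[R]_(m, n)) : mxintegrable D F ->
  mxintegrable D (fun t => P *m F t *m Q) /\
  mxRintegral D (fun t => P *m F t *m Q) = P *m mxRintegral D F *m Q.
Proof.
move=> iF.
have E (M : 'M[R]_(m, n)) i j :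
    (P *m M *m Q) i j = \sum_kl (P i kl.1 * Q kl.2 j) * M kl.1 kl.2.
  (* each entry of P M Q is a fixed linear combination of the entries of M *)
  rewrite mxE -(pair_bigA _ (fun k l => (P i k * Q l j) * M k l))/= exchange_big.
  apply: eq_bigr => l _; rewrite mxE mulr_suml.
  by apply: eq_bigr => k _; rewrite mulrAC.
have H i j := Rintegral_lincomb (fun kl => P i kl.1 * Q kl.2 j) mD
                (fun kl => iF kl.1 kl.2).
split=> [i j|]; first by have [+ _] := H i j; under eq_fun do rewrite -E.
apply/matrixP => i j; rewrite E mxE; have [_] := H i j.
under eq_fun do rewrite -E.
by move=> ->; apply: eq_bigr => kl _; rewrite mxE.
Qed.

Lemma mxRintegralD m n (F G : R -> 'M[R]_(m, n)) :
  mxintegrable D F -> mxintegrable D G ->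
  mxintegrable D (fun t => F t + G t) /\
  mxRintegral D (fun t => F t + G t) = mxRintegral D F + mxRintegral D G.
Proof.
move=> iF iG; split=> [i j|].
  by under eq_fun do rewrite mxE EFinD; exact: integrableD.
apply/matrixP => i j; rewrite !mxE; under eq_fun do rewrite mxE.
exact: (RintegralD mD (iF i j) (iG i j)).
Qed.

Lemma mxintegrable_trmx m n (F : R -> 'M[R]_(m, n)) :
  mxintegrable D F -> mxintegrable D (fun t => (F t)^T).
Proof. by move=> iF i j; under eq_fun do rewrite mxE; exact: iF. Qed.

Lemma mxRintegral_trmx m n (F : R -> 'M[R]_(m, n)) :
  mxRintegral D (fun t => (F t)^T) = (mxRintegral D F)^T.
Proof. by apply/matrixP => i j; rewrite !mxE; under eq_fun do rewrite mxE. Qed.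

(** Since [y^T W y = \tr (W y y^T)], a quadratic integral depends on [y] only
    through its second-moment matrix. *)
Lemma mxRintegral_quadratic n (w : R -> R) (y : R -> 'cV[R]_n) (W : 'M[R]_n) :
  mxintegrable D (fun t => w t *: (y t *m (y t)^T)) ->
  mxRintegral D (fun t => w t *: ((y t)^T *m W *m y t)) 0 0 =
  \tr (W *m mxRintegral D (fun t => w t *: (y t *m (y t)^T))).
Proof.
move=> iyy; have [iW] := mxintegrable_lin W 1%:M iyy; rewrite mulmx1 => <-.
rewrite mxE /mxtrace.
rewrite [RHS](eq_bigr (fun i =>
  1 * Rintegral (leb R) D (fun t =>
      (W *m (w t *: (y t *m (y t)^T)) *m 1%:M) i i))); last first.
  by move=> i _; rewrite mul1r mxE.
rewrite -(Rintegral_lincomb (fun _ => 1) mD (fun i => iW i i)).2.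
apply: eq_Rintegral => t _.
transitivity (\tr (W *m (w t *: (y t *m (y t)^T)) *m 1%:M)); last first.
  by apply: eq_bigr => i _; rewrite mul1r.
rewrite mulmx1 -scalemxAr mulmxA mxtraceZ mxtrace_mulC mulmxA mxE.
by rewrite /mxtrace big_ord1.
Qed.

End MatrixIntegral.

(** * Bessel's inequality *)

Lemma pdmx_unit (R : realType) (d : nat) (F : 'M[R]_d) : pdmx F -> F \in unitmx.
Proof.
move=> [sF pF]; rewrite -row_free_unit -kermx_eq0; apply/eqP/row_matrixP => i.
rewrite row0; apply/eqP; apply: contraT => nz.
(* a kernel vector v has v F v^T = 0, which definiteness forbids if v != 0 *)
have : (row i (kermx F))^T != 0 by rewrite trmx_eq0.
move/pF; rewrite /congmx trmxK -row_mul mulmx_ker row0 mul0mx mxE ltxx.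
by [].
Qed.

(** The residual [G] of the least-squares fit of [y] by [f] has second moment
    [S - A F^-1 A^T], where [S] is that of [y]; its pairing with [W] is the
    integral of a nonnegative function. *)
Lemma weighted_bessel (R : realType) (n d : nat) (D : set R) (w : R -> R)
    (W : 'M[R]_n) (y : R -> 'cV[R]_n) (f : R -> 'cV[R]_d) :
  measurable (D : set (leb_line R)) -> (forall t, D t -> 0 <= w t) ->
  psdmx W ->
  mxintegrable D (fun t => w t *: (y t *m (y t)^T)) ->
  mxintegrable D (fun t => w t *: (y t *m (f t)^T)) ->
  mxintegrable D (fun t => w t *: (f t *m (f t)^T)) ->
  gram D w f \in unitmx ->
  \tr (W *m (mxRintegral D (fun t => w t *: (y t *m (f t)^T)) *m
              invmx (gram D w f) *m
              (mxRintegral D (fun t => w t *: (y t *m (f t)^T)))^T)) <=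
  mxRintegral D (fun t => w t *: ((y t)^T *m W *m y t)) 0 0.
Proof.
move=> mD w0 [_ W0] iyy iyf iff; set F := gram D w f => uF.
set A := mxRintegral D (fun t => w t *: (y t *m (f t)^T)).
have FT : F^T = F.
  rewrite /F /gram -mxRintegral_trmx; congr mxRintegral; apply/funext => t.
  by rewrite linearZ/= trmx_mul trmxK.
pose B := A *m invmx F.
have BFB : B *m F *m B^T = A *m invmx F *m A^T.
  by rewrite /B mulmxKV// trmx_mul trmx_inv FT mulmxA.
have ABT : A *m B^T = A *m invmx F *m A^T.
  by rewrite /B trmx_mul trmx_inv FT mulmxA.
pose G t := y t - B *m f t.
have ify := mxintegrable_trmx iyf.
(* expand w G G^T into terms linear in the three moments of y and f *)
have GE : (fun t => w t *: (G t *m (G t)^T)) = (fun t =>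
    (1%:M *m (w t *: (y t *m (y t)^T)) *m 1%:M +
     1%:M *m (w t *: (y t *m (f t)^T)) *m (- B^T)) +
    ((- B) *m (w t *: (y t *m (f t)^T))^T *m 1%:M +
     B *m (w t *: (f t *m (f t)^T)) *m B^T)).
  apply/funext => t; rewrite /G !mul1mx !mulmx1.
  have -> : (w t *: (y t *m (f t)^T))^T = w t *: (f t *m (y t)^T).
    by rewrite linearZ/= trmx_mul trmxK.
  rewrite linearB/= trmx_mul mulmxN mulNmx.
  rewrite -!scalemxAr -!scalemxAl -!scalerN -!scalerDr; congr (_ *: _).
  by rewrite mulmxBl !mulmxBr !mulmxA opprB [- _ + _]addrC.
have [i1 e1] := mxintegrable_lin mD 1%:M 1%:M iyy.
have [i2 e2] := mxintegrable_lin mD 1%:M (- B^T) iyf.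
have [i3 e3] := mxintegrable_lin mD (- B) 1%:M ify.
have [i4 e4] := mxintegrable_lin mD B B^T iff.
have [i12 e12] := mxRintegralD mD i1 i2.
have [i34 e34] := mxRintegralD mD i3 i4.
have [iG eG] := mxRintegralD mD i12 i34.
rewrite -GE in iG eG.
rewrite e12 e34 e1 e2 e3 e4 !mul1mx !mulmx1 mxRintegral_trmx -/A in eG.
rewrite -[mxRintegral D (fun t => w t *: (f t *m (f t)^T))]/F BFB in eG.
rewrite mulmxN ABT mulNmx addNr addr0 in eG.
have G0 : 0 <= mxRintegral D (fun t => w t *: ((G t)^T *m W *m G t)) 0 0.
  rewrite mxE; apply: Rintegral_ge0 => t Dt.
  by rewrite mxE mulr_ge0 ?w0//; exact: W0.
move: G0; rewrite (mxRintegral_quadratic mD W iG) eG mulmxBr linearB/= subr_ge0.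
by rewrite (mxRintegral_quadratic mD W iyy).
Qed.
(** * Kronecker products and vectorisation *)

Section Kronecker.
Variable R : realType.

Lemma sum_mxtens (m d : nat) (g : 'I_(m * d) -> R) :
  \sum_k g k = \sum_i \sum_a g (mxtens_index (i, a)).
Proof.
rewrite (reindex (@mxtens_index m d)).
  rewrite (pair_bigA _ (fun i a => g (mxtens_index (i, a)))) /=.
  by apply: eq_bigr => -[].
exists (@mxtens_unindex m d) => k _; [exact: mxtens_indexK|exact: mxtens_unindexK].
Qed.

Lemma vecE (m d : nat) (B : 'M[R]_(d, m)) i a j :
  vec B (mxtens_index (i, a)) j = B a i.
Proof. by rewrite mxE mxtens_indexK. Qed.

(** The Kronecker product acts on vectorised matrices by two-sided
    multiplication; this turns every form below into a trace. *)
Lemma tensmx_vec (m d : nat) (S : 'M[R]_m) (P : 'M[R]_d) (B : 'M[R]_(d, m)) :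
  (S *t P) *m vec B = vec (P *m B *m S^T).
Proof.
apply/matrixP => k j; case: (mxtens_indexP k) => i a.
rewrite vecE mxE sum_mxtens mxE; apply: eq_bigr => i' _.
rewrite !mxE mulr_suml; apply: eq_bigr => b _.
by rewrite tensmxE vecE -mulrA mulrC.
Qed.

Lemma vec_dot (m d : nat) (B C : 'M[R]_(d, m)) :
  ((vec B)^T *m vec C) 0 0 = \tr (B^T *m C).
Proof.
rewrite mxE sum_mxtens; apply: eq_bigr => i _; rewrite mxE.
by apply: eq_bigr => a _; rewrite [(vec B)^T _ _]mxE [B^T _ _]mxE !vecE.
Qed.

Lemma congmx_tens (m d : nat) (S : 'M[R]_m) (P : 'M[R]_d) (A : 'M[R]_(m, d)) :
  S^T = S ->
  congmx (S *t P) (vec A^T) 0 0 = \tr (S *m (A *m P *m A^T)).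
Proof.
move=> ST; rewrite /congmx -mulmxA tensmx_vec vec_dot trmxK ST !mulmxA.
by rewrite mxtrace_mulC !mulmxA.
Qed.

Lemma congmx_cast (m m' p : nat) (e : m = m') (M : 'M[R]_m) (X : 'M[R]_(m', p)) :
  congmx (castmx (e, e) M) X = congmx M (castmx (esym e, erefl) X).
Proof. by case: m' / e X => X; rewrite !castmx_id. Qed.

Lemma cast_col_vec (m n d : nat) (A : 'M[R]_(m, d)) (B : 'M[R]_(n, d)) :
  castmx (esym (mulnDl m n d), erefl) (col_mx (vec A^T) (vec B^T)) =
  vec (col_mx A B)^T.
Proof.
apply/matrixP => k j; rewrite castmxE; case: (mxtens_indexP k) => ij a.

rewrite vecE [RHS]mxE; set q := cast_ord _ _.
case: (split_ordP ij) => i ij_i.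
  have -> : q = lshift (n * d) (mxtens_index (i, a)).
    by apply: val_inj; rewrite /= ij_i.
  by rewrite col_mxEu vecE ij_i col_mxEu mxE.
have -> : q = rshift (m * d) (mxtens_index (i, a)).
  by apply: val_inj; rewrite /= ij_i /= mulnDl addnA.
by rewrite col_mxEd vecE ij_i col_mxEd mxE.
Qed.

Lemma congmx_tens_block (n d : nat) (W : 'M[R]_(n + n)) (P : 'M[R]_d)
    (A B : 'M[R]_(n, d)) : W^T = W ->
  congmx (tens_block W P) (col_mx (vec A^T) (vec B^T)) 0 0 =
  \tr (W *m (col_mx A B *m P *m (col_mx A B)^T)).
Proof. by move=> WT; rewrite /tens_block congmx_cast cast_col_vec congmx_tens. Qed.

(** This identity and the next reduce both integrated vectors of the theorem to
    one moment matrix: since vectorisation is linear, it can be pulled out of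
    the integral, and the two orders of the Kronecker factors then differ only
    by a transposition. *)
Lemma tens1mx_vec (n d : nat) (v : 'cV[R]_d) (x : 'cV[R]_n) :
  tens1mx n v *m x = vec (x *m v^T)^T.
Proof.
apply/matrixP => k j; rewrite (ord1 j) {j}; case: (mxtens_indexP k) => i a.
rewrite vecE !mxE big_ord1 !mxE (bigD1 i)//= big1 ?addr0.
  rewrite castmxE/= cast_ord_id; set q := cast_ord _ _.
  have -> : q = mxtens_index (i, ord0) by apply: val_inj; rewrite /= muln1 addn0.
  by rewrite tensmxE mxE eqxx mul1r mulrC.
move=> i' ne; rewrite castmxE/= cast_ord_id; set q := cast_ord _ _.
have -> : q = mxtens_index (i', ord0) by apply: val_inj; rewrite /= muln1 addn0.
by rewrite tensmxE mxE eq_sym (negbTE ne) !mul0r.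
Qed.

Lemma tensmx1_vec (n d : nat) (v : 'cV[R]_d) (x : 'cV[R]_n) :
  tensmx1 n v *m x = vec (x *m v^T).
Proof.
apply/matrixP => k j; rewrite (ord1 j) {j}; case: (mxtens_indexP k) => a i.
rewrite vecE !mxE big_ord1 !mxE (bigD1 i)//= big1 ?addr0.
  rewrite castmxE/= cast_ord_id; set q := cast_ord _ _.
  have -> : q = mxtens_index (ord0, i) by exact: val_inj.
  by rewrite tensmxE mxE eqxx mulr1 mulrC.
move=> i' ne; rewrite castmxE/= cast_ord_id; set q := cast_ord _ _.
have -> : q = mxtens_index (ord0, i') by exact: val_inj.
by rewrite tensmxE [1%:M _ _]mxE eq_sym (negbTE ne) mulr0 mul0r.
Qed.

Lemma commutation_mx_vec (n d : nat) (A : 'M[R]_(n, d)) :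
  commutation_mx R n d *m vec A = vec A^T.
Proof. by move: A; apply/commutation_mxP. Qed.

Lemma trmx_commutation (n d : nat) :
  (commutation_mx R n d)^T = commutation_mx R d n.
Proof. by apply/matrixP => k l; rewrite !mxE andbC eq_sym [X in _ && X]eq_sym. Qed.

Lemma congmx_commutation (n d : nat) (M : 'M[R]_(n * d + n * d))
    (A B : 'M[R]_(n, d)) :
  congmx (dsummx (commutation_mx R d n) (commutation_mx R d n) *m M *m
          dsummx (commutation_mx R n d) (commutation_mx R n d))
    (col_mx (vec A) (vec B)) =
  congmx M (col_mx (vec A^T) (vec B^T)).
Proof.
have E : col_mx (vec A^T) (vec B^T) =
    dsummx (commutation_mx R n d) (commutation_mx R n d) *m col_mx (vec A) (vec B).
  by rewrite /dsummx mul_block_col !mul0mx addr0 add0r !commutation_mx_vec.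
rewrite E /congmx trmx_mul /dsummx tr_block_mx !trmx0 !trmx_commutation.
by rewrite !mulmxA.
Qed.

Lemma mxRintegral_vec m d (D : set R) (F : R -> 'M[R]_(m, d)) :
  mxRintegral D (fun t => vec (F t)) = vec (mxRintegral D F).
Proof. by apply/matrixP => k j; rewrite !mxE; under eq_fun do rewrite mxE. Qed.

End Kronecker.
(** * Cutting a function in two *)

Lemma mxintegrable_coordL2w (R : realType) (m d : nat) (K : set R) (w : R -> R)
    (phi : R -> 'cV[R]_m) (psi : R -> 'cV[R]_d) :
  measurable (K : set (leb_line R)) ->
  weight K w -> coordL2w K w phi -> coordL2w K w psi ->
  mxintegrable K (fun t => w t *: (phi t *m (psi t)^T)).
Proof.
move=> mK hw hphi hpsi i j.
under eq_fun => t do rewrite mxE mxE big_ord1 [_^T _ _]mxE.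
exact: coordL2w_mul_integrable.
Qed.

(** The two halves of the cut are disjoint, while the two intervals of
    integration share an endpoint; that endpoint is a null set. *)
Lemma mxRintegral_itv_obnd_cbnd (R : realType) (m n : nat) (a b : R)
    (F : R -> 'M[R]_(m, n)) : mxintegrable `[a, b] F ->
  mxRintegral `]a, b] F = mxRintegral `[a, b] F.
Proof.
move=> iF; apply/matrixP => i j; rewrite !mxE /Rintegral; congr fine.
rewrite -(setDitv1l (BRight b) a true).
apply/esym/negligible_integral => //; try exact: measurable_leb_line.
exact: completed_lebesgue_set1.
Qed.

Section Splitting.
Variables (R : realType) (n : nat) (B : set R).

Definition split_on (x : R -> 'cV[R]_n) (t : R) : 'cV[R]_(n + n) :=
  col_mx (\1_B t *: x t) (\1_(~` B) t *: x t).

Lemma split_onE (x : R -> 'cV[R]_n) (t : R) :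
  split_on x t = col_mx (x t) 0 \/ split_on x t = col_mx 0 (x t).
Proof.
rewrite /split_on !indicE in_setC; case: (t \in B) => /=.
- by left; rewrite scale1r scale0r.
- by right; rewrite scale1r scale0r.
Qed.

(** The off-diagonal block [Y] always meets a vanishing half. *)
Lemma split_on_quadratic (U Y : 'M[R]_n) (x : R -> 'cV[R]_n) (t : R) :
  (split_on x t)^T *m block_mx U Y Y^T U *m split_on x t =
  (x t)^T *m U *m x t.
Proof.
case: (split_onE x t) => ->; rewrite tr_col_mx trmx0 mul_row_block mul_row_col.
- by rewrite !mul0mx !addr0 mulmx0 addr0.
- by rewrite !mul0mx !add0r mulmx0 add0r.
Qed.

Lemma coordL2w_split_on (K : set R) (w : R -> R) (x : R -> 'cV[R]_n) :
  measurable (B : set (leb_line R)) ->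
  coordL2w K w x -> coordL2w K w (split_on x).
Proof.
move=> mB [mx fin]; split=> [i|]; last first.
  move: fin; congr (_ < _)%E; apply: eq_integral => t _; congr (_ * _)%:E.
  by case: (split_onE x t) => ->; rewrite tr_col_mx mul_row_col trmx0 mul0mx ?addr0 ?add0r.
case: (split_ordP i) => k ->.
  under eq_fun do rewrite col_mxEu mxE.
  by apply: measurable_funM => //; exact: measurable_indic.
under eq_fun do rewrite col_mxEd mxE.
apply: measurable_funM => //; apply: measurable_indic; exact: measurableC.
Qed.

Lemma mxRintegral_split_on (d : nat) (K : set R) (w : R -> R)
    (x : R -> 'cV[R]_n) (f : R -> 'cV[R]_d) :
  mxRintegral K (fun t => w t *: (split_on x t *m (f t)^T)) =
  col_mx (mxRintegral (K `&` B) (fun t => w t *: (x t *m (f t)^T)))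
         (mxRintegral (K `&` ~` B) (fun t => w t *: (x t *m (f t)^T))).
Proof.
apply/matrixP => i j; rewrite [LHS]mxE.
have E (C : set R) k : Rintegral (leb R) (K `&` C)
      (fun t => (w t *: (x t *m (f t)^T)) k j) =
    Rintegral (leb R) K
      (fun t => (w t *: ((\1_C t *: x t) *m (f t)^T)) k j).
  (* restricting the domain to C is multiplying by the indicator of C *)
  rewrite Rintegral_mkcondr; apply: eq_Rintegral => t _.
  by rewrite patch_indic/= -scalemxAl [in RHS]mxE [in RHS]mxE mxE mulrCA mulrC.
case: (split_ordP i) => k ->.
  rewrite col_mxEu mxE E; apply: eq_Rintegral => t _.
  by rewrite /split_on mul_col_mx scale_col_mx col_mxEu.
rewrite col_mxEd mxE E; apply: eq_Rintegral => t _.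
by rewrite /split_on mul_col_mx scale_col_mx col_mxEd.
Qed.

End Splitting.

Unset Implicit Arguments.

Theorem lemma7p3 (R : realType) (r1 r2 : R) (hr1 : 0 <= r1) (hr12 : r1 < r2)
    (n d : nat) (w : R -> R) (hw : weight `[- r2, - r1] w)
    (U : 'M[R]_n) (hU : psdmx U)
    (f : R -> 'cV[R]_d) (hf : L2w `[- r2, - r1] w f)
    (hF : pdmx (gram `[- r2, - r1] w f)) :
  forall (x : R -> 'cV[R]_n), L2w `[- r2, - r1] w x ->
  forall rho : R, r1 <= rho <= r2 ->
  forall Y : 'M[R]_n, psdmx (block_mx U Y Y^T U) ->
  let Finv := invmx (gram `[- r2, - r1] w f) in
  let M := tens_block (block_mx U Y Y^T U) Finv in
  let X := col_mx
    (mxRintegral `[- rho, - r1] (fun t => w t *: (tens1mx n (f t) *m x t)))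
    (mxRintegral `[- r2, - rho] (fun t => w t *: (tens1mx n (f t) *m x t))) in
  let Z := col_mx
    (mxRintegral `[- rho, - r1] (fun t => w t *: (tensmx1 n (f t) *m x t)))
    (mxRintegral `[- r2, - rho] (fun t => w t *: (tensmx1 n (f t) *m x t))) in
  let Kdn := commutation_mx R d n in
  let Knd := commutation_mx R n d in
  congmx M X 0 0 <=
    mxRintegral `[- r2, - r1] (fun t => w t *: ((x t)^T *m U *m x t)) 0 0 /\
  congmx M X 0 0 =
    congmx (dsummx Kdn Kdn *m M *m dsummx Knd Knd) Z 0 0.
Proof.
move=> x hx rho /andP[r1rho rhor2] Y hW Finv M X Z Kdn Knd.
pose A (D : set R) := mxRintegral D (fun t => w t *: (x t *m (f t)^T)).
have XE D : mxRintegral D (fun t => w t *: (tens1mx n (f t) *m x t)) = vec (A D)^T.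
  rewrite -mxRintegral_trmx -mxRintegral_vec; congr mxRintegral; apply/funext => t.
  by rewrite tens1mx_vec; apply/matrixP => i j; rewrite !mxE.
have ZE D : mxRintegral D (fun t => w t *: (tensmx1 n (f t) *m x t)) = vec (A D).
  rewrite -mxRintegral_vec; congr mxRintegral; apply/funext => t.
  by rewrite tensmx1_vec; apply/matrixP => i j; rewrite !mxE.
split; last by rewrite /X /Z !XE !ZE congmx_commutation.
have mK : measurable (`[- r2, - r1] : set (leb_line R)).
  exact: measurable_leb_line.
pose B : set R := `]- rho, +oo[%classic.
have mB : measurable (B : set (leb_line R)).
  by apply: measurable_leb_line; exact: measurable_itv.
have L2f := L2w_coordL2w hf; have L2x := L2w_coordL2w hx.
have L2y := coordL2w_split_on mB L2x.
have KB : `[- r2, - r1] `&` B = `]- rho, - r1]%classic.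
  apply/seteqP; split=> t; rewrite /B /= !in_itv/= andbT.
    by move=> [/andP[_ ->] ->].
  by move=> /andP[h ->]; split=> //; rewrite andbT ltW// (le_lt_trans _ h)// lerN2.
have KCB : `[- r2, - r1] `&` ~` B = `[- r2, - rho]%classic.
  apply/seteqP; split=> t; rewrite /B /= !in_itv/= andbT.
    by move=> [/andP[-> _] /negP]; rewrite -leNgt.
  move=> /andP[-> h]; split; last by apply/negP; rewrite -leNgt.
  by rewrite (le_trans h)// lerN2.
have AE : mxRintegral `[- r2, - r1]
    (fun t => w t *: (split_on B x t *m (f t)^T)) =
    col_mx (A `[- rho, - r1]%classic) (A `[- r2, - rho]%classic).
  rewrite mxRintegral_split_on KB KCB mxRintegral_itv_obnd_cbnd// => i j.
  have := mxintegrable_coordL2w mK hw L2x L2f i j.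
  apply: integrableS => //; first exact: measurable_leb_line.
  by move=> t; rewrite /= !in_itv/= => /andP[h ->]; rewrite andbT (le_trans _ h)// lerN2.
have [_ w0 _] := hw.
have := weighted_bessel mK w0 hW
  (mxintegrable_coordL2w mK hw L2y L2y) (mxintegrable_coordL2w mK hw L2y L2f)
  (mxintegrable_coordL2w mK hw L2f L2f) (pdmx_unit hF).
rewrite AE /X /M !XE congmx_tens_block; last by case: hW.
by under [X in _ <= mxRintegral _ X _ _ -> _]eq_fun do rewrite split_on_quadratic.
Qed.
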